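(* Let $X$ be a normed space, let $R: X\to(-\infty,\infty]$ be convex, proper, and locally Lipschitz on its effective domain $\mathrm{dom}\,R$ (not only on the interior of the domain), and let $F: X\to\mathbb{R}$. Let $x\in\mathrm{dom}\,R$. Then the following hold: (i) $\partial_F F(x)+\partial_F R(x)\subset\partial_F[F+R](x)$. (ii) If $\partial_{|A}R(x)\ne\emptyset$ for a set $A\subset X$, then $$\partial_F[F+R](x)\subset\partial_F F_A(x)+\tilde x^*\quad\text{for any}\quad\tilde x^*\in\partial_{|A}R(x).$$
   Context: $\mathrm{dom}\,R=\{x\mid R(x)<\infty\}$. Fréchet subdifferential of $F:X\to(-\infty,\infty]$ at $x$ with $F(x)$ finite: $\partial_F F(x)=\{x^*\in X^*\mid \liminf_{\tilde x\to x}\frac{F(\tilde x)-F(x)-\langle x^*|\tilde x-x\rangle}{\|\tilde x-x\|}\ge 0\}$. $A$-lower subdifferential: $$\partial_{|A}R(x)=\Bigl\{x^*\in\partial_F R(x)\Bigm|\limsup_{A\ni x^k\to x}\frac{R(x^k)-R(x)-\langle x^*|x^k-x\rangle}{\|x^k-x\|}\le0\Bigr\}.$$ $F_A$ denotes $F$ restricted to $A$ (that is, $F_A(x)=F(x)$ for $x\in A$ and $F_A(x)=\emptyset$ for $x\notin A$); accordingly $\partial_F F_A(x)$ is the set of $x^*\in X^*$ with $\limsup_{A\ni x^k\to x}\frac{\langle x^*|x^k-x\rangle-(F(x^k)-F(x))}{\|x^k-x\|}\le 0$. *)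

(* Defs.v *)
From HB Require Import structures.
From mathcomp Require Import all_boot all_order all_algebra.
From mathcomp Require Import all_classical all_reals all_analysis.

Set Implicit Arguments.
Unset Strict Implicit.
Unset Printing Implicit Defensive.

Import Order.TTheory GRing.Theory Num.Theory.
Import numFieldNormedType.Exports.

Local Open Scope classical_set_scope.
Local Open Scope ring_scope.

Section definitions.
Context (K : realType) (X : normedModType K).
Implicit Types (G R : X -> \bar K) (F : X -> K) (A : set X) (x : X).

Definition topological_dual : set (X -> K) :=
  [set f | linear (f : X -> K^o) /\ continuous f].

Definition effective_domain G : set X := [set x | (G x < +oo)%E].

Definition econvex G :=
  forall (t : K) (x y : X), 0 <= t <= 1 ->
    (G (t *: x + (1 - t) *: y)%R <= t%:E * G x + (1 - t)%R%:E * G y)%E.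

Definition eproper G :=
  (forall x, (-oo < G x)%E) /\ effective_domain G !=set0.

Definition locally_lipschitz_on_domain G :=
  forall x, effective_domain G x -> exists2 U, nbhs x U &
    [lipschitz (fine (G y) : K^o) | y in U `&` effective_domain G].

(* The punctured neighbourhood filter [x^'] discards the 0/0 quotient at [x].
   The subdifferential is empty at points where [G] is not finite. *)
Definition frechet_subdiff G x : set (X -> K) :=
  [set f | [/\ topological_dual f, G x \is a fin_num &
    (0 <= limf_einf
       (fun y : X => (G y - G x - (f (y - x)%R)%:E) / `|y - x|%R%:E) x^')%E]].

(* If [x] is isolated from [A], the limit superior is that of an empty set
   of values, hence [-oo], and the condition holds trivially. *)
Definition lower_subdiff A R x : set (X -> K) :=
  [set f | frechet_subdiff R x f /\
    (limf_esup
       (fun y : X => (R y - R x - (f (y - x)%R)%:E) / `|y - x|%R%:E)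
       (within A x^') <= 0)%E].

(* The subdifferential at [x] of the restriction of [F] to [A]; the point [x]
   is not required to belong to [A]. *)
Definition frechet_subdiff_restr A F x : set (X -> K) :=
  [set f | topological_dual f /\
    (limf_esup
       (fun y : X => ((f (y - x) - (F y - F x)) / `|y - x|)%:E)
       (within A x^') <= 0)%E].

End definitions.

(* Main.v *)
Require Import Defs.
From HB Require Import structures.
From mathcomp Require Import all_boot all_order all_algebra.
From mathcomp Require Import all_classical all_reals all_analysis.
From mathcomp Require Import lra.
Import Order.TTheory GRing.Theory Num.Theory.
Import numFieldNormedType.Exports.
Local Open Scope classical_set_scope.
Local Open Scope ring_scope.

(** Clearing the denominator, each (sub)differential condition becomes a first-order
    estimate up to an error [e * `|y - x|] near [x]. Lower estimates of [F] and [R] add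
    up. Conversely, along [A] the function [R] also has a matching upper estimate with
    slope [w], which in particular makes it finite there, so it can be subtracted from
    the lower estimate of [F + R]. *)

(** [limf_esup] is an infimum of suprema over the sets of [F], so a bound by [e] on one such set is
    all that matters. [F] may be improper: [within A x^'] contains the empty set when [x] is
    isolated from [A]. *)
Lemma limf_esup_le0P (T : pnbhsType) (K : realType) (g : T -> \bar K)
    (F : set_system T) {FF : Filter F} :
  (limf_esup g F <= 0)%E <->
  (forall e : K, 0 < e -> \forall y \near F, (g y <= e%:E)%E).
Proof.
split => [g0 e e0|gF].
  have /ereal_inf_lt[_ [V FV <-] Ve] : (limf_esup g F < e%:E)%E.
    by rewrite (le_lt_trans g0)// lte_fin.
  apply: filterS FV => y Vy; apply: le_trans (ltW Ve).
  by apply: ereal_sup_ubound; exists y.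
apply/lee_addgt0Pr => e e0; rewrite add0e; apply: ge_ereal_inf.
(* The sublevel set of [g] at height [e] lies in [F] by hypothesis. *)
exists (ereal_sup [set g y | y in [set y | (g y <= e%:E)%E]]).
  by exists [set y | (g y <= e%:E)%E] => //; exact: gF.
by apply: ge_ereal_sup => _ [y ye <-].
Qed.

Lemma limf_einf_ge0P (T : pnbhsType) (K : realType) (g : T -> \bar K)
    (F : set_system T) {FF : Filter F} :
  (0 <= limf_einf g F)%E <->
  (forall e : K, 0 < e -> \forall y \near F, ((- e)%:E <= g y)%E).
Proof.
rewrite /limf_einf oppe_ge0.
split => [/limf_esup_le0P gF e e0|gF].
  by near do rewrite EFinN leeNl; exact: gF.
apply/limf_esup_le0P => e e0.
by near do rewrite leeNl -EFinN; exact: gF.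
Unshelve. all: by end_near. Qed.

(** Only [r] may be infinite: both sides are true at [+oo] and false at [-oo], and for real [r] this
    is multiplication by [d > 0]. *)
Lemma ereal_quotient_ge (K : realFieldType) (r a : \bar K) (c d e : K) :
  0 < d -> a \is a fin_num ->
  ((- e)%:E <= (r - a - c%:E) / d%:E)%E = ((fine a + c - e * d)%:E <= r)%E.
Proof.
move=> d0 /fineK <-; rewrite inver gt_eqF// lee_pdivlMr//.
case: r => [r||]//=; last by rewrite !leey.
rewrite -!EFinB -EFinM !lee_fin; apply/idP/idP => ?; lra.
Qed.

Lemma ereal_quotient_le (K : realFieldType) (r a : \bar K) (c d e : K) :
  0 < d -> a \is a fin_num ->
  ((r - a - c%:E) / d%:E <= e%:E)%E = (r <= (fine a + c + e * d)%:E)%E.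
Proof.
move=> d0 /fineK <-; rewrite inver gt_eqF// lee_pdivrMr//.
case: r => [r||]//=; last by rewrite !leNye.
rewrite -!EFinB -EFinM !lee_fin; apply/idP/idP => ?; lra.
Qed.

Section first_order.
Context (K : realType) (X : normedModType K).
Implicit Types (G : X -> \bar K) (F : X -> K) (f g : X -> K) (A : set X).

Lemma topological_dualD f g :
  topological_dual f -> topological_dual g -> topological_dual (f \+ g).
Proof.
move=> [lf cf] [lg cg]; split; last by move=> y; apply: cvgD; [exact: cf|exact: cg].
by move=> a u v /=; rewrite lf lg scalerDr addrACA.
Qed.

Lemma topological_dualB f g :
  topological_dual f -> topological_dual g -> topological_dual (f \- g).
Proof.
move=> [lf cf] [lg cg]; split; last by move=> y; apply: cvgB; [exact: cf|exact: cg].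
by move=> a u v /=; rewrite lf lg scalerBr opprD addrACA.
Qed.

Lemma frechet_subdiffP G (x : X) f :
  frechet_subdiff G x f <->
  [/\ topological_dual f, G x \is a fin_num & forall e : K, 0 < e ->
    \forall y \near x^',
      ((fine (G x) + f (y - x) - e * `|y - x|)%:E <= G y)%E].
Proof.
(* The denominator is positive only for [y != x], so the two forms of the estimate agree eventually
   along [x^']. *)
have quotE e : G x \is a fin_num -> \forall y \near x^',
    ((- e)%:E <= (G y - G x - (f (y - x)%R)%:E) / `|y - x|%R%:E)%E =
    ((fine (G x) + f (y - x) - e * `|y - x|)%:E <= G y)%E.
  move=> Gx; apply: filterS (@nbhs_dnbhs_neq _ x) => y yx.
  by rewrite ereal_quotient_ge// normr_gt0 subr_eq0.
split=> -[fX Gx fG]; split=> //.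
  move/limf_einf_ge0P : fG => + e e0 => /(_ e e0).
  by apply: filterS2 (quotE e Gx) => y ->.
apply/limf_einf_ge0P => e e0; have := fG e e0.
by apply: filterS2 (quotE e Gx) => y ->.
Qed.

Lemma lower_subdiffP A G (x : X) f :
  lower_subdiff A G x f <-> frechet_subdiff G x f /\
    forall e : K, 0 < e -> \forall y \near within A x^',
      (G y <= (fine (G x) + f (y - x) + e * `|y - x|)%:E)%E.
Proof.
have quotE e : G x \is a fin_num -> \forall y \near within A x^',
    ((G y - G x - (f (y - x)%R)%:E) / `|y - x|%R%:E <= e%:E)%E =
    (G y <= (fine (G x) + f (y - x) + e * `|y - x|)%:E)%E.
  move=> Gx; apply: filterS (@nbhs_dnbhs_neq _ x) => y yx _.
  by rewrite ereal_quotient_le// normr_gt0 subr_eq0.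
split=> -[fG fA]; split=> //; have [_ Gx _] := fG.
  move/limf_esup_le0P : fA => + e e0 => /(_ e e0).
  by apply: filterS2 (quotE e Gx) => y ->.
apply/limf_esup_le0P => e e0; have := fA e e0.
by apply: filterS2 (quotE e Gx) => y ->.
Qed.

Lemma frechet_subdiff_restrP A F (x : X) f :
  frechet_subdiff_restr A F x f <-> topological_dual f /\
    forall e : K, 0 < e -> \forall y \near within A x^',
      f (y - x) - (F y - F x) <= e * `|y - x|.
Proof.
have quotE e : \forall y \near within A x^',
    (((f (y - x) - (F y - F x)) / `|y - x|)%:E <= e%:E)%E =
    (f (y - x) - (F y - F x) <= e * `|y - x|).
  apply: filterS (@nbhs_dnbhs_neq _ x) => y yx _.
  by rewrite lee_fin ler_pdivrMr// normr_gt0 subr_eq0.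
split=> -[fX fA]; split=> //.
  move/limf_esup_le0P : fA => + e e0 => /(_ e e0).
  by apply: filterS2 (quotE e) => y ->.
apply/limf_esup_le0P => e e0; have := fA e e0.
by apply: filterS2 (quotE e) => y ->.
Qed.

Lemma frechet_subdiffD F G (x : X) u v :
  frechet_subdiff (EFin \o F) x u -> frechet_subdiff G x v ->
  frechet_subdiff (fun y => (F y)%:E + G y)%E x (u \+ v).
Proof.
move=> /frechet_subdiffP[uX _ uF] /frechet_subdiffP[vX Gx vG].
apply/frechet_subdiffP; split; first exact: topological_dualD.
  by rewrite fin_numD Gx.
move=> e e0; have e20 : 0 < e / 2 by rewrite divr_gt0.
apply: filterS2 (uF _ e20) (vG _ e20) => y /=.
(* The value [-oo] contradicts the lower estimate of [G], and at [+oo] the sum is [+oo]; for real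
   values the two errors with [e / 2] add up to [e]. *)
rewrite -(fineK Gx); case: (G y) => [r||]//=; last by rewrite !leey.
by rewrite -EFinD !lee_fin => ? ?; lra.
Qed.

Lemma frechet_subdiffB_lower A F G (x : X) f w :
  (forall y, -oo < G y)%E ->
  lower_subdiff A G x w ->
  frechet_subdiff (fun y => (F y)%:E + G y)%E x f ->
  frechet_subdiff_restr A F x (f \- w).
Proof.
move=> Gy /lower_subdiffP[[wX Gx _] wA] /frechet_subdiffP[fX _ fG].
apply/frechet_subdiff_restrP; split; first exact: topological_dualB.
move=> e e0; have e20 : 0 < e / 2 by rewrite divr_gt0.
(* With [G x] written as a real number, [fine] of the sum at [x] computes; the estimate is then
   restricted to [A], where the upper one holds. *)
have := fG _ e20; rewrite -(fineK Gx) => /(cvg_within A) fGA.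
apply: filterS2 fGA (wA _ e20) => y /=.
(* [Gy] excludes [-oo] and the upper estimate along [A] excludes [+oo], so [G y] is real and can be
   cancelled. *)
have := Gy y; rewrite -(fineK Gx); case: (G y) => [r||]//= _.
by rewrite -EFinD !lee_fin => ? ?; lra.
Qed.

End first_order.

Theorem theorem2p10 (K : realType) (X : normedModType K)
    (R : X -> \bar K) (F : X -> K) (x : X)
    (R_convex : econvex R) (R_proper : eproper R)
    (R_lipschitz : locally_lipschitz_on_domain R)
    (x_dom : effective_domain R x) :
  [set u \+ v | u in frechet_subdiff (EFin \o F) x & v in frechet_subdiff R x]
    `<=` frechet_subdiff (fun y => (F y)%:E + R y)%E x
  /\
  (forall A : set X, lower_subdiff A R x !=set0 ->
    forall w, lower_subdiff A R x w ->
      frechet_subdiff (fun y => (F y)%:E + R y)%E x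
        `<=` [set u \+ w | u in frechet_subdiff_restr A F x]).
Proof.
split=> [_ [u uF [v vR <-]]|A _ w wR f fFR]; first exact: frechet_subdiffD.
(* The decomposition [f = u \+ w] forces this choice of [u]. *)
exists (f \- w); last by apply/funext => y /=; rewrite subrK.
by apply: frechet_subdiffB_lower wR fFR; case: R_proper.
Qed.
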